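(* Let $G=(V,E)$ be a locally finite, connected, weighted graph with edge weight $\omega$ satisfying $\omega_{\min}>0$ and with vertex measure $\mu$, and suppose that $D_\mu<\infty$ and $D_\omega<\infty$ and that $G$ satisfies the curvature dimension condition $CDE'(n,0)$. Let $m>0$ and $\zeta,\eta\ge 0$, and suppose that there exist $c',c''>0$, $r_0>1$ and $x_0\in V$ such that $$c'\,r^m(\log r)^{-\zeta}\le \mathcal{V}(x_0,r)\le c''\,r^m(\log r)^{\eta}\qquad\text{for all } r\ge r_0 .$$ Let $a:V\to\mathbb{R}$ be bounded with $\inf_{x\in V}a(x)=a_0>0$. If $0<\alpha\le\frac{2}{m}$, then every non-negative solution $u$ of $$\partial_t u=\Delta u+u^{1+\alpha}\ \text{ in } (0,+\infty)\times V,\qquad u(0,x)=a(x)\ \text{ for } x\in V,$$ blows up in a finite time.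
   Context: Graphs. $G=(V,E)$ is a locally finite, connected graph without loops or multiple edges; $y\sim x$ means that $x,y$ are joined by an edge. The edge weight $\omega:V\times V\to[0,\infty)$ satisfies $\omega_{xy}=\omega_{yx}$, and $\omega_{xy}>0$ iff $x\sim y$; $\omega_{\min}:=\inf_{(x,y)\in E}\omega_{xy}>0$. The measure is a function $\mu:V\to(0,\infty)$, $\mu_{\max}:=\sup_{x\in V}\mu(x)$, $m(x):=\sum_{y\sim x}\omega_{xy}$, and $$D_\omega:=\frac{\mu_{\max}}{\omega_{\min}},\qquad D_\mu:=\sup_{x\in V}\frac{m(x)}{\mu(x)}.$$ $d(x,y)$ is the number of edges in a shortest path joining $x$ and $y$; $B_r=B_r(x_0)$ is the set of vertices at distance at most $r$ from $x_0$; $\mathcal{V}(x_0,r)=\sum_{y\in B_r(x_0)}\mu(y)$. Laplacian. For $f:V\to\mathbb{R}$, $\Delta f(x)=\frac{1}{\mu(x)}\sum_{y\sim x}\omega_{xy}(f(y)-f(x))$. Curvature. Put $2\Gamma(f,g)=\Delta(fg)-f\Delta g-g\Delta f$, $2\Gamma_2(f,g)=\Delta\Gamma(f,g)-\Gamma(f,\Delta g)-\Gamma(\Delta f,g)$, $\Gamma(f)=\Gamma(f,f)$, $\Gamma_2(f)=\Gamma_2(f,f)$. $G$ satisfies $CDE'(n,K)$ if for every positive function $f:V\to(0,\infty)$ and every $x\in V$, $$\Gamma_2(f)(x)-\Gamma\Big(f,\frac{\Gamma(f)}{f}\Big)(x)\ge \frac1n f(x)^2(\Delta\log f)(x)^2+K\,\Gamma(f)(x).$$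 Solutions and blow-up. For $T>0$, a non-negative function $u=u(t,x)$ is a non-negative solution of the problem in $[0,T]$ if $u$ is continuous with respect to $t$ and satisfies the problem (equation and initial condition) in $[0,T]\times V$. For a solution $u$, let $T_\infty$ be the supremum of all $T$ such that for any $T'<T$ the solution $u$ is bounded in $[0,T']\times V$. The solution blows up in a finite time if $T_\infty<\infty$; it is global if $T_\infty=\infty$. *)

(* Defs.v *)
From HB Require Import structures.
From mathcomp Require Import all_boot all_order all_algebra.
From mathcomp Require Import all_classical all_reals all_analysis.

Set Implicit Arguments.
Unset Strict Implicit.
Unset Printing Implicit Defensive.

Import Order.TTheory GRing.Theory Num.Theory.
Import numFieldNormedType.Exports.

Local Open Scope classical_set_scope.
Local Open Scope ring_scope.

Record wgraph (R : realType) (V : choiceType) := WGraph {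
  adj : rel V;
  weight : V -> V -> R;
  meas : V -> R;
  adj_sym : symmetric adj;
  adj_irr : irreflexive adj;
  adj_connected : forall x y, exists p : seq V, path adj x p && (last x p == y);
  adj_locally_finite : forall x, finite_set [set y | adj x y];
  weight_ge0 : forall x y, 0 <= weight x y;
  weight_sym : forall x y, weight x y = weight y x;
  weight_gt0 : forall x y, (0 < weight x y) = adj x y;
  meas_gt0 : forall x, 0 < meas x }.

Section Graph.
Context (R : realType) (V : choiceType) (G : wgraph R V).
Implicit Types (f g : V -> R) (x y : V).

(* The finitely supported sum below is a genuine sum over the neighbours of x,
   which form a finite set. *)
Definition nsum x (F : V -> R) : R := \sum_(y \in [set y | adj G x y]) F y.

Definition wdeg x : R := nsum x (weight G x).

(* Suprema and infima are taken in the extended reals, so that no default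
   value is involved when they are infinite. *)
Definition omega_min : \bar R :=
  ereal_inf [set (weight G p.1 p.2)%:E | p in [set p | adj G p.1 p.2]].

Definition mu_max : \bar R := ereal_sup (range (fun x => (meas G x)%:E)).

Definition D_omega : \bar R := (mu_max / omega_min)%E.

Definition D_mu : \bar R := ereal_sup (range (fun x => (wdeg x / meas G x)%:E)).

Definition walk_of_length x y (n : nat) : bool :=
  `[< exists p : seq V, [/\ path (adj G) x p, last x p = y & size p = n] >].

Lemma walk_of_length_ex x y : exists n, walk_of_length x y n.
Proof.
have [p /andP[pP /eqP pl]] := adj_connected G x y.
by exists (size p); apply/asboolP; exists p.
Qed.

Definition gdist x y : nat := ex_minn (walk_of_length_ex x y).

Definition gball x (r : R) : set V := [set y | (gdist x y)%:R <= r].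

Lemma finite_walk x (n : nat) : finite_set [set y | walk_of_length x y n].
Proof.
elim: n => [|n IHn].
  apply: (@sub_finite_set _ _ [set x]); last exact: finite_set1.
  by move=> y /= /asboolP[p [_ <- /size0nil ->]].
apply: (@sub_finite_set _ _
  (\bigcup_(z in [set z | walk_of_length x z n]) [set y | adj G z y])).
  move=> y /= /asboolP[p]; case: (lastP p) => [[]//|q z [+ <-]].
  rewrite rcons_path last_rcons size_rcons => /andP[pq qz] [sq].
  by exists (last x q) => //=; apply/asboolP; exists q.
by apply: bigcup_finite => // z _; exact: adj_locally_finite.
Qed.

Lemma finite_gball x (r : R) : finite_set (gball x r).
Proof.
apply: (@sub_finite_set _ _
  (\bigcup_(n in `I_(Num.truncn r).+1) [set y | walk_of_length x y n])).
  move=> y; rewrite /gball /= /gdist; case: ex_minnP => n wn _ nr.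
  exists n => //=; rewrite ltnS.
  by rewrite truncn_ge_nat// (le_trans _ nr).
by apply: bigcup_finite => [|n _]; [exact: finite_II | exact: finite_walk].
Qed.

(* A sum over a finite set, by finite_gball. *)
Definition volume x (r : R) : R := \sum_(y \in gball x r) meas G y.

Definition laplacian f : V -> R := fun x =>
  (meas G x)^-1 * nsum x (fun y => weight G x y * (f y - f x)).

Definition Gamma f g : V -> R := fun x =>
  2^-1 * (laplacian (fun y => f y * g y) x
          - f x * laplacian g x - g x * laplacian f x).

Definition Gamma2 f g : V -> R := fun x =>
  2^-1 * (laplacian (Gamma f g) x
          - Gamma f (laplacian g) x - Gamma (laplacian f) g x).

Definition CDE' (n K : R) : Prop :=
  forall f, (forall y, 0 < f y) -> forall x,
    Gamma2 f f x - Gamma f (fun y => Gamma f f y / f y) x >=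
    n^-1 * f x ^+ 2 * laplacian (fun y => ln (f y)) x ^+ 2 + K * Gamma f f x.

Section Problem.
Context (alpha : R) (a : V -> R).
Implicit Type u : R -> V -> R.

(* Only the values u t x with 0 <= t <= T matter. The two-sided derivative is
   required on the open interval; at T, the one-sided version of the equation
   follows by continuity, the right-hand side being a finite sum. *)
Definition nonneg_solution u (T : R) : Prop :=
  [/\ forall t x, 0 <= t <= T -> 0 <= u t x,
      forall x, {within `[0, T], continuous (fun t => u t x)},
      forall t x, 0 < t < T ->
        is_derive t (1 : R) (fun s => u s x)
          (laplacian (u t) x + u t x `^ (1 + alpha))
    & forall x, u 0 x = a x].

Definition bounded_upto u (T : R) : Prop :=
  exists M : R, forall t x, 0 <= t <= T -> `|u t x| <= M.

(* Since u is a total function of time, its being a solution on [0, T'] is part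
   of the condition: the values of u outside its interval of existence are
   irrelevant. *)
Definition blow_up_time u : \bar R :=
  ereal_sup [set T%:E | T in
    [set T | 0 <= T /\
       forall T', 0 < T' < T -> nonneg_solution u T' /\ bounded_upto u T']].

Definition blows_up_in_finite_time u : Prop := (blow_up_time u < +oo)%E.

End Problem.
End Graph.

(* Main.v *)
Require Import Defs.
From mathcomp Require Import all_boot all_order all_algebra.
From mathcomp Require Import all_classical all_reals all_analysis.
From mathcomp Require Import ring lra.

Local Open Scope classical_set_scope.
Local Open Scope ring_scope.

Set Implicit Arguments.
Unset Strict Implicit.
Unset Printing Implicit Defensive.

(** Since [a >= a0 > 0] everywhere and [D_mu] is finite, it is enough to compare
    [u] with spatially constant subsolutions. By the minimum principle, [u >= c] at
    time [s] gives [u >= c + c^(1+alpha) (t - s)] for [t >= s], so that a lower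
    bound [c] doubles within time [c^(-alpha)]. Starting from [a0], the successive
    doubling times form a convergent geometric series, after the sum of which [u]
    would exceed every [2^k a0]. *)

Import Order.TTheory GRing.Theory Num.Theory.
Import numFieldNormedType.Exports.

(** * Minimum principle for supersolutions of the heat equation *)

Section MinimumPrinciple.
Context (R : realType) (V : choiceType) (G : wgraph R V).
Implicit Types (f : V -> R) (x : V).

Lemma laplacianBC f (k : R) x :
  laplacian G (fun y => f y - k) x = laplacian G f x.
Proof.
rewrite /laplacian /nsum; congr (_ * _); apply: eq_fsbigr => y _.
by congr (_ * _); ring.
Qed.

(** Dropping the nonnegative terms in [f y] leaves only the diagonal part of the Laplacian. *)
Lemma laplacian_ge f x : (forall y, 0 <= f y) ->
  - (wdeg G x / meas G x) * f x <= laplacian G f x.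
Proof.
move=> f0; rewrite /laplacian /wdeg /nsum.
rewrite !(fsbig_finite _ _ (adj_locally_finite G x)).
have -> (S m : R) : - (S / m) * f x = m^-1 * (S * - f x) by ring.
rewrite ler_pM2l ?invr_gt0 ?meas_gt0// mulr_suml; apply: ler_sum => y _.
by rewrite ler_wpM2l ?weight_ge0// lerDr.
Qed.

Lemma wdeg_meas_le : (D_mu G < +oo)%E ->
  exists2 D : R, 0 <= D & forall x, wdeg G x / meas G x <= D.
Proof.
move=> Dfin; exists (Num.max 0 (fine (D_mu G))); first by rewrite le_max lexx.
move=> x; rewrite le_max; apply/orP; right.
have le_D : ((wdeg G x / meas G x)%:E <= D_mu G)%E.
  by apply: ereal_sup_ubound; exists x.
by move: Dfin le_D; case: (D_mu G) => //= r _; rewrite lee_fin.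
Qed.

(** With the integrating factor, [expR (D * (r - s)) * g r] has nonnegative derivative, so the mean
    value theorem compares its endpoint values. *)
Lemma gronwall_ge (g dg : R -> R) (D s t : R) : s <= t ->
  {within `[s, t], continuous g} ->
  (forall r, s < r < t -> is_derive r (1 : R) g (dg r)) ->
  (forall r, s < r < t -> - D * g r <= dg r) ->
  expR (- (D * (t - s))) * g s <= g t.
Proof.
move=> st cg Dg dg_ge.
pose F r := expR (D * (r - s)) * g r.
pose dF r := expR (D * (r - s)) * (D * g r + dg r).
have DF r : r \in `]s, t[ -> is_derive r (1 : R) F (dF r).
  rewrite in_itv /= => /Dg Dgr; rewrite /F.
  by apply: is_derive_eq; rewrite /dF /GRing.scale /=; ring.
have cF : {within `[s, t], continuous F}.
  have cE : continuous (fun r : R => expR (D * (r - s))).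
    move=> r; apply: (@continuous_comp _ _ _ (fun r : R => D * (r - s))).
      by apply: cvgM; [exact: cvg_cst | apply: cvgB; [exact: cvg_id | exact: cvg_cst]].
    exact: continuous_expR.
  move=> r; apply: cvgM; last exact: cg.
  by have := continuous_subspaceT cE; apply.
move: st; rewrite le_eqVlt => /predU1P[<-|lt_st].
  by rewrite subrr mulr0 oppr0 expR0 mul1r.
have [r] := MVT lt_st DF cF; rewrite in_itv /= => rst FE.
have : 0 <= F t - F s.
  rewrite FE mulr_ge0 ?subr_ge0 ?(ltW lt_st)// /dF mulr_ge0 ?expR_ge0//.
  by have := dg_ge _ rst; lra.
rewrite /F subrr mulr0 expR0 mul1r subr_ge0 => gs.
by rewrite expRN ler_pdivrMl ?expR_gt0.
Qed.

(** On an infinite graph a minimum need not be attained, so the argument uses the infimum over the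
    whole strip; the bound [K] makes it finite. *)
Lemma minimum_principle (v dv : R -> V -> R) (K s T : R) :
  (D_mu G < +oo)%E ->
  (forall t x, s <= t <= T -> K <= v t x) ->
  (forall x, {within `[s, T], continuous (fun t => v t x)}) ->
  (forall t x, s < t < T -> is_derive t (1 : R) (fun r => v r x) (dv t x)) ->
  (forall t x, s < t < T -> laplacian G (v t) x <= dv t x) ->
  (forall x, 0 <= v s x) ->
  forall t x, s <= t <= T -> 0 <= v t x.
Proof.
move=> /wdeg_meas_le[D D0 degD] vK cv Dv dv_ge v0 t0 x0 t0I.
pose A := [set v p.1 p.2 | p in [set p : R * V | s <= p.1 <= T]].
have A0 : A !=set0 by exists (v t0 x0), (t0, x0).
have infA_le t x : s <= t <= T -> inf A <= v t x.
  move=> tI; apply: ge_inf; last by exists (t, x).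
  by exists K => _ [[r y] /= rI <-]; exact: vK.
apply: (le_trans _ (infA_le _ x0 t0I)); rewrite leNgt; apply/negP => infA_lt0.
pose e := expR (- (D * (T - s))).
(* As [v - inf A >= 0], its derivative is at least [- D (v - inf A)], so that
   [v - inf A] decays at most by the factor [e] from its initial value, which is
   at least [- inf A]. *)
suff lb : (1 - e) * inf A <= inf A.
  (* As [inf A < 0], [lb] would force [e <= 0]. *)
  by have := expR_gt0 (- (D * (T - s))); rewrite -/e => e0; nra.
apply: lb_le_inf => // _ [[t x] /= tI <-].
have /andP[st tT] := tI.
have stT r : s < r < t -> s < r < T.
  by move=> /andP[-> rt]; exact: lt_le_trans rt tT.
have : expR (- (D * (t - s))) * (v s x - inf A) <= v t x - inf A.
  apply: (@gronwall_ge (fun r => v r x - inf A) (dv^~ x)) => //.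
  - move=> r; apply: cvgB; last exact: cvg_cst.
    move: r; apply: continuous_subspaceW (cv x) => r /=.
    by rewrite !in_itv /= => /andP[-> rt]; exact: le_trans rt tT.
  - move=> r /stT rI; have Dvr := Dv _ x rI.
    by apply: is_derive_eq; rewrite subr0.
  - move=> r /stT rI; apply: (le_trans _ (dv_ge _ _ rI)).
    have w0 y : 0 <= v r y - inf A.
      by rewrite subr_ge0 infA_le//; case/andP: rI => /ltW -> /ltW ->.
    rewrite -(laplacianBC _ (inf A)); apply: (le_trans _ (laplacian_ge x w0)).
    by rewrite ler_wpM2r// lerN2.
(* The decay factor over the full strip bounds the one up to [t], uniformly in [t]. *)
have : e <= expR (- (D * (t - s))).
  by rewrite ler_expR lerN2 ler_wpM2l// lerB.
have : 0 < e by exact: expR_gt0.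
have := v0 x; nra.
Qed.

End MinimumPrinciple.

(** * Lower bounds for solutions by repeated doubling *)

Section LowerBounds.
Context (R : realType) (V : choiceType) (G : wgraph R V).
Context (alpha : R) (a : V -> R) (u : R -> V -> R) (T : R).
Hypothesis D_mu_fin : (D_mu G < +oo)%E.
Hypothesis alpha_gt0 : 0 < alpha.
Hypothesis u_sol : nonneg_solution G alpha a u T.

Let u_ge0 t x : 0 <= t <= T -> 0 <= u t x.
Proof. by case: u_sol => + _ _ _; apply. Qed.

(** The minimum principle applies to [u] minus the affine function of time, which the Laplacian does
    not see. *)
Lemma solution_minimum (s c k : R) : 0 <= s ->
  (forall t x, s < t < T -> k <= u t x `^ (1 + alpha)) ->
  (forall x, c <= u s x) ->
  forall t x, s <= t <= T -> c + k * (t - s) <= u t x.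
Proof.
move=> s0 k_le c_le t0 x0 t0I; rewrite -subr_ge0.
have [_ cu Du _] := u_sol.
have sT t : s <= t <= T -> 0 <= t <= T.
  by move=> /andP[st ->]; rewrite (le_trans s0 st).
have sTo t : s < t < T -> 0 < t < T.
  by move=> /andP[st ->]; rewrite (le_lt_trans s0 st).
apply: (@minimum_principle _ _ G
  (fun t x => u t x - (c + k * (t - s)))
  (fun t x => laplacian G (u t) x + u t x `^ (1 + alpha) - k)
  (* This lower bound comes from [u >= 0] and [t <= T]. *)
  (- (`|c| + `|k| * (T - s))) s T) => //.
- move=> t x tI; have := u_ge0 x (sT _ tI).
  have : k * (t - s) <= `|k| * (T - s).
    case/andP: tI => st tT; apply: (@le_trans _ _ (`|k| * (t - s))).
      by rewrite ler_wpM2r ?subr_ge0 ?ler_norm.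
    by rewrite ler_wpM2l// lerB.
  by have := ler_norm c; lra.
- move=> x t; apply: cvgB.
    move: t; apply: continuous_subspaceW (cu x) => r /=.
    by rewrite !in_itv /=; exact: sT.
  have cl : continuous (fun t : R => c + k * (t - s)).
    move=> r; apply: cvgD; first exact: cvg_cst.
    apply: cvgM; first exact: cvg_cst.
    by apply: cvgB; [exact: cvg_id | exact: cvg_cst].
  by have := continuous_subspaceT cl; apply.
- move=> t x /sTo tI; have Dut := Du _ x tI.
  by apply: is_derive_eq; rewrite /GRing.scale /=; ring.
- move=> t x tI; rewrite laplacianBC.
  by have := k_le _ x tI; lra.
- by move=> x; rewrite subrr mulr0 addr0 subr_ge0.
Qed.

(** Rate [0] shows that the bound [c] persists; then rate [c^(1+alpha)] is available, and it gains
    exactly [c] over a time [c^(-alpha)]. *)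
Lemma lower_bound_double (s c : R) : 0 <= s -> 0 < c ->
  s + c `^ (- alpha) <= T -> (forall x, c <= u s x) ->
  forall x, 2 * c <= u (s + c `^ (- alpha)) x.
Proof.
move=> s0 c0 hT c_le x.
have sT t : s < t < T -> 0 <= t <= T.
  by move=> /andP[st /ltW ->]; rewrite (le_trans s0 (ltW st)).
have c_leT t y : s <= t <= T -> c <= u t y.
  move=> tI; rewrite -[leLHS]addr0 -(mul0r (t - s)).
  by apply: solution_minimum => // r z /sT rI; exact: powR_ge0.
have k_le t y : s < t < T -> c `^ (1 + alpha) <= u t y `^ (1 + alpha).
  move=> tI; have cu : c <= u t y.
    by apply: c_leT; case/andP: tI => /ltW -> /ltW ->.
  apply: ge0_ler_powR => //; rewrite ?nnegrE; last 2 first.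
  - exact: ltW.
  - exact: le_trans (ltW c0) cu.
  by rewrite addr_ge0// ltW.
have := @solution_minimum s c _ s0 k_le c_le (s + c `^ (- alpha)) x.
rewrite lerDl powR_ge0 hT => /(_ isT); apply: le_trans.
rewrite addrAC subrr add0r -powRD; last by rewrite (gt_eqF c0) implybT.
by rewrite addrK powRr1 ?(ltW c0)// mulr_natl mulr2n.
Qed.

Let pow2N_lt1 : 2 `^ (- alpha) < 1 :> R.
Proof.
have := @gt0_ltr_powR _ _ alpha_gt0 1 2.
rewrite powR1 !nnegrE ler01 ler0n ltr1n => /(_ isT isT isT) lt1.
by rewrite powRN invf_lt1// powR_gt0.
Qed.

(** Each doubling of the bound multiplies the next doubling time by [q = 2^(-alpha)]. The times in
    the conclusion are the partial sums of this geometric series, and [S] is its sum. *)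
Lemma lower_bound_pow2 (c S : R) : 0 < c -> (forall x, c <= u 0 x) ->
  S = c `^ (- alpha) / (1 - 2 `^ (- alpha)) -> S <= T ->
  forall k x, 2 ^+ k * c <= u (S * (1 - (2 `^ (- alpha)) ^+ k)) x.
Proof.
set q := 2 `^ (- alpha) => c0 c_le SE ST.
have q0 : 0 < q by rewrite powR_gt0.
have q1 : q < 1 by exact: pow2N_lt1.
have S0 : 0 <= S by rewrite SE divr_ge0 ?powR_ge0// subr_ge0 ltW.
have powE k : (2 ^+ k * c) `^ (- alpha) = q ^+ k * c `^ (- alpha).
  rewrite powRM ?exprn_ge0 ?(ltW c0)//; congr (_ * _).
  by rewrite -powR_mulrn// powRAC powR_mulrn// powR_ge0.
have stepE k : S * (1 - q ^+ k) + (2 ^+ k * c) `^ (- alpha) =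
    S * (1 - q ^+ k.+1).
  rewrite powE SE exprS; field; lra.
have S_le k : S * (1 - q ^+ k) <= S by rewrite ler_piMr// gerDl oppr_le0 exprn_ge0 ?ltW.
elim=> [|k IHk] x; first by rewrite !expr0 mul1r subrr mulr0.
rewrite exprS -mulrA -stepE; apply: lower_bound_double => //.
- by rewrite mulr_ge0// subr_ge0 exprn_ile1 ?ltW.
- by rewrite mulr_gt0// exprn_gt0.
- by rewrite stepE (le_trans (S_le _)).
Qed.

(** A vertex is required: on an empty graph the hypotheses hold for every [T]. *)
Lemma solution_time_lt (c : R) : V -> 0 < c -> (forall x, c <= u 0 x) ->
  T < c `^ (- alpha) / (1 - 2 `^ (- alpha)).
Proof.
move=> x0 c0 c_le; rewrite ltNge; apply/negP => ST.
set S := c `^ (- alpha) / _ in ST.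
have pow2 := lower_bound_pow2 c0 c_le erefl ST.
have q1 := pow2N_lt1.
have S0 : 0 <= S by rewrite divr_ge0 ?powR_ge0// subr_ge0 ltW.
have u_ge k : 2 ^+ k * c <= u S x0.
  have qk : 0 <= (2 `^ (- alpha)) ^+ k <= 1.
    by rewrite exprn_ge0 ?exprn_ile1 ?powR_ge0 ?(ltW q1).
  set s := S * (1 - (2 `^ (- alpha)) ^+ k).
  have s0 : 0 <= s by rewrite mulr_ge0// subr_ge0; case/andP: qk.
  have sS : s <= S by rewrite ler_piMr// gerDl oppr_le0; case/andP: qk.
  (* The bound reached at time [s] persists until [S], by rate [0]. *)
  rewrite -[leLHS]addr0 -(mul0r (S - s)).
  apply: (@solution_minimum s) => //; last by rewrite sS.
  by move=> *; exact: powR_ge0.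
have uS0 : 0 <= u S x0 by rewrite u_ge0// S0.
(* Some [N] satisfies [u S x0 < N * c < 2^N * c], against the bound for [k = N]. *)
have := archi_boundP (divr_ge0 uS0 (ltW c0)).
set N := Num.bound _; rewrite ltr_pdivrMr// => ltN.
have ltXN : N%:R < 2 ^+ N :> R by rewrite -natrX ltr_nat ltn_expl.
have : 2 ^+ N * c < 2 ^+ N * c.
  by rewrite (le_lt_trans (u_ge N))// (lt_trans ltN)// ltr_pM2r.
by rewrite ltxx.
Qed.

End LowerBounds.

Theorem theorem1p2 (R : realType) (V : choiceType) (G : wgraph R V)
  (n m zeta eta alpha a0 : R) (a : V -> R)
  (omega_min_gt0 : (0 < omega_min G)%E)
  (D_mu_fin : (D_mu G < +oo)%E)
  (D_omega_fin : (D_omega G < +oo)%E)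
  (n_gt0 : 0 < n)
  (curvature : CDE' G n 0)
  (m_gt0 : 0 < m) (zeta_ge0 : 0 <= zeta) (eta_ge0 : 0 <= eta)
  (growth : exists (c' c'' r0 : R) (x0 : V),
    [/\ 0 < c', 0 < c'', 1 < r0 &
      forall r, r0 <= r ->
        c' * r `^ m * ln r `^ (- zeta) <= volume G x0 r <=
        c'' * r `^ m * ln r `^ eta])
  (a_bounded : exists M : R, forall x, `|a x| <= M)
  (a_inf : inf (range a) = a0) (a0_gt0 : 0 < a0)
  (alpha_gt0 : 0 < alpha) (alpha_le : alpha <= 2 / m)
  (u : R -> V -> R)
  (u_solution : exists T : R, 0 < T /\ nonneg_solution G alpha a u T) :
  blows_up_in_finite_time G alpha a u.
Proof.
have [_ [_ [_ [x0 _]]]] := growth.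
have a0_le x : a0 <= a x.
  rewrite -a_inf; apply: ge_inf; last by exists x.
  (* A real [inf] is a lower bound only for a set bounded below, hence the appeal to [a_bounded]. *)
  by have [M aM] := a_bounded; exists (- M) => _ [y _ <-]; rewrite lerNnormlW.
rewrite /blows_up_in_finite_time.
set S := a0 `^ (- alpha) / (1 - 2 `^ (- alpha)).
apply: (@le_lt_trans _ _ (Num.max 0 S)%:E); last exact: ltry.
apply: ge_ereal_sup => _ [T [_ solT] <-]; rewrite lee_fin leNgt gt_max.
apply/negP => /andP[T0 ST].
(* Membership of [T] gives a solution only up to times strictly below [T], so a midpoint is taken;
   the maximum with [0] ensures [T' > 0]. *)
pose T' := (Num.max 0 S + T) / 2.
have [T'0 ST' T'T] : [/\ 0 < T', S <= T' & T' < T].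
  by rewrite /T' maxEle; case: ifPn; rewrite -?ltNge => ?; split; lra.
have [|solT' _] := solT T'; first by rewrite T'0.
have : T' < S.
  apply: (solution_time_lt D_mu_fin alpha_gt0 solT' x0 a0_gt0) => x.
  by case: solT' => _ _ _ ->.
by rewrite ltNge ST'.
Qed.
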